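(* Let $G$ be a $\{B, D, K_4, K_{2,3}, P_2 \,\Box\, P_3\}$-free graph. Then $\gamma(H) = \gamma_e(H)$ for every induced subgraph $H$ of $G$ if and only if $G$ is $\{P_7, C_7, F_1, F_2, F_3, F_4, F_5\}$-free.
   Context: All graphs are finite, simple, and undirected. For a set $\mathcal{F}$ of graphs, a graph $G$ is $\mathcal{F}$-free if no induced subgraph of $G$ is isomorphic to a member of $\mathcal{F}$. Domination. A set $D$ of vertices of a graph $G$ is a dominating set of $G$ if every vertex of $G$ not in $D$ has a neighbor in $D$. The domination number $\gamma(G)$ is the minimum order of a dominating set of $G$. Exponential domination. Let $D$ be a set of vertices of a graph $G$. For two (not necessarily distinct) vertices $u,v$ of $G$, let $\mathrm{dist}_{(G,D)}(u,v)$ be the minimum length (number of edges) of a path $P$ in $G$ between $u$ and $v$ such that $D$ contains exactly one endvertex of $P$ but no internal vertex of $P$; if no such path exists, $\mathrm{dist}_{(G,D)}(u,v)=\infty$. In particular, if $u$ and $v$ are distinct vertices in $D$, then $\mathrm{dist}_{(G,D)}(u,u)=0$ and $\mathrm{dist}_{(G,D)}(u,v)=\infty$. For a vertex $u$ of $G$ let $$w_{(G,D)}(u)=\sum_{v\in D}\left(\tfrac12\right)^{\mathrm{dist}_{(G,D)}(u,v)-1},$$ where $\left(\tfrac12\right)^{\infty}=0$ (so $w_{(G,D)}(u)=2$ for $u\in D$). The set $D$ is an exponential dominating set of $G$ if $w_{(G,D)}(u)\ge 1$ for every vertex $u$ of $G$. The exponential domination number $\gamma_e(G)$ is the minimum order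 of an exponential dominating set of $G$. Specific graphs. $P_n$ and $C_n$ are the path and the cycle of order $n$; $K_n$ is the complete graph of order $n$; $K_{2,3}$ is the complete bipartite graph with parts of sizes 2 and 3; $\Box$ denotes the Cartesian product, so $P_2 \,\Box\, P_3$ is the $2\times 3$ grid. - $B$ (bull): vertices $a,b,c,a',b'$, edges $ab, bc, ca, aa', bb'$. - $D$ (diamond): $K_4$ with one edge removed. (In the claim, $D$ denotes this graph, not a vertex set.) - $F_1$: vertices $a,b,c,a',b',c'$, edges $ab, bc, aa', bb', cc'$ (a path on three vertices with one pendant vertex attached to each of its vertices). - $F_2$: vertices $a,b,c,d,p,q,r$, edges $ab, bc, cd, da, ap, pq, qr$ (a 4-cycle with a pendant path of three edges attached at one of its vertices). - $F_3$: vertices $a,b,c,d,p,q,r$, edges $ab, bc, cd, da, ap, pq, qr, rb$ (a 4-cycle and a 5-cycle sharing exactly the edge $ab$ and its endpoints). - $F_4$: vertices $a,b,c,d,p,q,r$, edges $ab, bc, cd, da, ap, pq, qr, ra$ (two 4-cycles sharing exactly one vertex $a$). - $F_5$: vertices $a,b,c,d,e,f,g$, edges $ab, bc, cd, da, be, ef, fd, cg$ (a 4-cycle $abcd$, a path $b\,e\,f\,d$ of three edges joining the opposite vertices $b$ and $d$ through two new vertices $e,f$, and a pendant vertex $g$ attached to $c$). *)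

(* Defs.v *)
From Stdlib Require List.
From HB Require Import structures.
From mathcomp Require Import all_boot all_order all_algebra.

Set Implicit Arguments.
Unset Strict Implicit.
Unset Printing Implicit Defensive.

Record sgraph := SGraph {
  vertex :> finType;
  adj : rel vertex;
  adj_sym : symmetric adj;
  adj_irr : irreflexive adj }.

Section Induced.
Variables (G : sgraph) (S : {set G}).

Definition induced_adj : rel {x : G | x \in S} :=
  fun x y => adj (val x) (val y).

Lemma induced_adj_sym : symmetric induced_adj.
Proof. by move=> x y; rewrite /induced_adj adj_sym. Qed.

Lemma induced_adj_irr : irreflexive induced_adj.
Proof. by move=> x; rewrite /induced_adj adj_irr. Qed.

Definition induced : sgraph := SGraph induced_adj_sym induced_adj_irr.
End Induced.

Definition isomorphic (G H : sgraph) : Prop :=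
  exists2 f : G -> H, bijective f & forall x y, adj (f x) (f y) = adj x y.

Definition induced_free (Fs : seq sgraph) (G : sgraph) : Prop :=
  forall (S : {set G}) (F : sgraph),
    List.In F Fs -> ~ isomorphic (induced S) F.

Section Domination.
Variable G : sgraph.
Implicit Types (D : {set G}) (u v : G).

Definition dominating D : bool :=
  [forall u, (u \notin D) ==> [exists v in D, adj u v]].

(* The default [set: G] is itself a dominating set, so this is the minimum. *)
Definition domination_number : nat :=
  #|[arg min_(D < [set: G] | dominating D) #|D|]|.

(* u :: p is a path from u to v with size p edges. Its endvertices form the
   set [set u; v], a single vertex when p is empty, and its internal vertices
   are those of behead (belast u p). *)
Definition Dpath D u v (p : seq G) : bool :=
  [&& path (@adj G) u p, last u p == v, uniq (u :: p),
      #|D :&: [set u; v]| == 1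
    & all [predC D] (behead (belast u p))].

(* None stands for infinity. A path with n edges has n.+1 distinct vertices,
   so only lengths n < #|G| occur; the first one that does is the minimum. *)
Definition Ddist D u v : option nat :=
  ohead [seq n <- iota 0 #|G| | [exists p : n.-tuple G, Dpath D u v p]].

Definition exp_weight D u : rat :=
  (\sum_(v in D)
     if Ddist D u v is Some d then (1 / 2 : rat) ^ (d%:Z - 1) else 0)%R.

Definition exp_dominating D : bool := [forall u, (1 <= exp_weight D u)%R].

(* The default [set: G] has weight 2 at every vertex, so it is exponential
   dominating and this is the minimum. *)
Definition exp_domination_number : nat :=
  #|[arg min_(D < [set: G] | exp_dominating D) #|D|]|.

End Domination.

(* The simple graph obtained from r by symmetrizing and discarding loops. *)
Section OfRel.
Variables (T : finType) (r : rel T).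

Definition simple_adj : rel T := fun x y => (x != y) && (r x y || r y x).

Lemma simple_adj_sym : symmetric simple_adj.
Proof. by move=> x y; rewrite /simple_adj eq_sym orbC. Qed.

Lemma simple_adj_irr : irreflexive simple_adj.
Proof. by move=> x; rewrite /simple_adj eqxx. Qed.

Definition graph_of_rel : sgraph := SGraph simple_adj_sym simple_adj_irr.
End OfRel.

Definition path_graph (n : nat) : sgraph :=
  graph_of_rel (fun i j : 'I_n => i.+1 == j).

(* The cycle of order n for n >= 3. *)
Definition cycle_graph (n : nat) : sgraph :=
  graph_of_rel (fun i j : 'I_n => i.+1 %% n == j).

Definition complete_graph (n : nat) : sgraph :=
  graph_of_rel (fun i j : 'I_n => true).

Definition complete_bipartite (m n : nat) : sgraph :=
  graph_of_rel (fun x y : 'I_m + 'I_n =>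
    match x, y with inl _, inr _ => true | _, _ => false end).

Definition cartesian_product (G H : sgraph) : sgraph :=
  graph_of_rel (fun x y : G * H =>
    ((x.1 == y.1) && adj x.2 y.2) || (adj x.1 y.1 && (x.2 == y.2))).

Definition graph_of_edges (n : nat) (E : seq (nat * nat)) : sgraph :=
  graph_of_rel (fun i j : 'I_n => (nat_of_ord i, nat_of_ord j) \in E).

(* a, b, c, a', b' = 0, ..., 4 *)
Definition bull : sgraph :=
  graph_of_edges 5 [:: (0, 1); (1, 2); (2, 0); (0, 3); (1, 4)].

(* K_4 without the edge 01 *)
Definition diamond : sgraph :=
  graph_of_edges 4 [:: (0, 2); (0, 3); (1, 2); (1, 3); (2, 3)].

(* a, b, c, a', b', c' = 0, ..., 5 *)
Definition F1 : sgraph :=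
  graph_of_edges 6 [:: (0, 1); (1, 2); (0, 3); (1, 4); (2, 5)].

(* In F2, F3 and F4, a, b, c, d, p, q, r = 0, ..., 6. *)
Definition F2 : sgraph :=
  graph_of_edges 7
    [:: (0, 1); (1, 2); (2, 3); (3, 0); (0, 4); (4, 5); (5, 6)].

Definition F3 : sgraph :=
  graph_of_edges 7
    [:: (0, 1); (1, 2); (2, 3); (3, 0); (0, 4); (4, 5); (5, 6); (6, 1)].

Definition F4 : sgraph :=
  graph_of_edges 7
    [:: (0, 1); (1, 2); (2, 3); (3, 0); (0, 4); (4, 5); (5, 6); (6, 0)].

(* a, b, c, d, e, f, g = 0, ..., 6 *)
Definition F5 : sgraph :=
  graph_of_edges 7
    [:: (0, 1); (1, 2); (2, 3); (3, 0); (1, 4); (4, 5); (5, 3); (2, 6)].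

(* Main.v *)
Require Import Defs.
From mathcomp Require Import all_boot.
From mathcomp Require Import all_order all_algebra.
Import Order.TTheory GRing.Theory Num.Theory.

Set Implicit Arguments.
Unset Strict Implicit.
Unset Printing Implicit Defensive.

(** If an obstruction F among P_7, C_7, F_1, ..., F_5 occurs as an induced
    subgraph, then it is itself a subgraph on which the two numbers differ: no
    two vertices dominate F, but F has two vertices p and q such that every
    vertex is dominated by p or q or is at distance two from both, so that it
    receives 1/2 + 1/2 (gap_domination_numbers).

    The converse rests on one structural fact: in a graph without any of the
    twelve obstructions, every connected component is dominated by two of its
    vertices (component_two_dominated). Given this, let D be an exponential
    dominating set and C a component. If D has at least two vertices in C,
    trade them for a dominating pair of C. If it has only one, v, then the
    weight of a vertex u of C is the single term 2 ^ (1 - dist(u, v)), and this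
    is at least 1 only if u is v or a neighbour of v; so v alone dominates C.
    It cannot have none. Hence some dominating set is no larger than D, while
    every dominating set is exponential dominating.

    For the structural fact, start with a vertex u and take a largest connected
    set B that contains u and is dominated by two of its vertices x and y,
    possibly equal. If B is not the whole component, some v outside B has a
    neighbour w in B, and no pair of vertices dominates A = B + v. So v is
    adjacent to neither x nor y, every other vertex of A is adjacent or equal
    to x or y, and for all p and q in A there is a z in A that p and q leave
    undominated. Together with v, w, x, y and a shortest link between x and y
    inside B, this yields a connected configuration on four to six known
    vertices. As long as a pair p, q dominates the known vertices, its witness
    z is a new vertex, nonadjacent to p and q and adjacent to x or y. Trying
    all remaining adjacencies of z to the known vertices, almost every one
    completes an obstruction, and the few others are grown again. This tree of
    cases is finite and small; the boolean function refuted walks it,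
    starts_refuted records that every branch ends in an obstruction, and
    refuted_sound turns such a run into a contradiction. *)

(** * Induced copies and edge lists *)

Definition induced_copy (F G : sgraph) (f : F -> G) : Prop :=
  injective f /\ {mono f : x y / adj x y}.

Lemma induced_copy_comp (F G H : sgraph) (f : F -> G) (g : G -> H) :
  induced_copy f -> induced_copy g -> induced_copy (g \o f).
Proof.
move=> [injf monof] [injg monog]; split=> [|x y]; first exact: inj_comp.
by rewrite /= monog monof.
Qed.

Lemma val_induced_copy (G : sgraph) (S : {set G}) :
  @induced_copy (induced S) G val.
Proof. by split; first exact: val_inj. Qed.

(** Pulling the subset and its isomorphism into a map from F makes obstructions
    composable: they pass to induced subgraphs and along relabellings. *)
Lemma induced_free_copy Fs (F G : sgraph) (f : F -> G) :
  induced_free Fs G -> List.In F Fs -> ~ induced_copy f.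
Proof.
move=> freeG inF [injf monof].
pose S := [set f x | x in [set: F]].
have fS x : f x \in S by exact: imset_f.
pose h x : induced S := exist _ (f x) (fS x).
have injh : injective h by move=> x y /(congr1 val)/injf.
have [|g hK gK] := @inj_card_bij F (induced S) h injh.
  by rewrite card_sig (card_imset _ injf) cardsT.
apply: (freeG S F inF); exists g; first by exists h.
by move=> x y; rewrite -{2}(gK x) -{2}(gK y) /adj /= /induced_adj /= monof.
Qed.

(** The adjacency of graph_of_edges on bare numbers, on which it computes. *)
Definition edge (E : seq (nat * nat)) (i j : nat) : bool :=
  (i != j) && (((i, j) \in E) || ((j, i) \in E)).

Lemma adj_graph_of_edges n E (i j : 'I_n) :
  @adj (graph_of_edges n E) i j = edge E i j.
Proof. by []. Qed.

(** Every obstruction as an order and an edge list, so that all twelve can be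
    searched for by the same program. Here: P_7, C_7, F_1, ..., F_5. *)
Definition gap_codes : seq (nat * seq (nat * nat)) :=
  [:: (7, [:: (0, 1); (1, 2); (2, 3); (3, 4); (4, 5); (5, 6)]);
      (7, [:: (0, 1); (1, 2); (2, 3); (3, 4); (4, 5); (5, 6); (6, 0)]);
      (6, [:: (0, 1); (1, 2); (0, 3); (1, 4); (2, 5)]);
      (7, [:: (0, 1); (1, 2); (2, 3); (3, 0); (0, 4); (4, 5); (5, 6)]);
      (7, [:: (0, 1); (1, 2); (2, 3); (3, 0); (0, 4); (4, 5); (5, 6); (6, 1)]);
      (7, [:: (0, 1); (1, 2); (2, 3); (3, 0); (0, 4); (4, 5); (5, 6); (6, 0)]);
      (7, [:: (0, 1); (1, 2); (2, 3); (3, 0); (1, 4); (4, 5); (5, 3); (2, 6)])].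

(** The bull, the diamond, K_4, K_{2,3} and the grid. *)
Definition host_codes : seq (nat * seq (nat * nat)) :=
  [:: (5, [:: (0, 1); (1, 2); (2, 0); (0, 3); (1, 4)]);
      (4, [:: (0, 2); (0, 3); (1, 2); (1, 3); (2, 3)]);
      (4, [:: (0, 1); (0, 2); (0, 3); (1, 2); (1, 3); (2, 3)]);
      (5, [:: (0, 2); (0, 3); (0, 4); (1, 2); (1, 3); (1, 4)]);
      (6, [:: (0, 1); (1, 2); (3, 4); (4, 5); (0, 3); (1, 4); (2, 5)])].

Definition obstruction_codes := host_codes ++ gap_codes.

Definition obstruction_free (G : sgraph) : Prop :=
  forall o, o \in obstruction_codes ->
  forall f : graph_of_edges o.1 o.2 -> G, ~ induced_copy f.

Lemma mem_iota_ord n (i : 'I_n) : (i : nat) \in iota 0 n.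
Proof. by rewrite mem_iota add0n ltn_ord. Qed.

Lemma ord_of_iota n i : i \in iota 0 n -> exists j : 'I_n, i = j.
Proof. by rewrite mem_iota add0n => lt_in; exists (Ordinal lt_in). Qed.

Definition host_graphs : seq sgraph :=
  [:: bull; diamond; complete_graph 4; complete_bipartite 2 3;
      cartesian_product (path_graph 2) (path_graph 3)].

Definition gap_graphs : seq sgraph :=
  [:: path_graph 7; cycle_graph 7; F1; F2; F3; F4; F5].

Definition same_adj n E (r : rel nat) : bool :=
  all (fun i => all (fun j => edge E i j == (i != j) && (r i j || r j i))
    (iota 0 n)) (iota 0 n).

Lemma same_adjP n E (r : rel nat) (i j : 'I_n) : same_adj n E r ->
  @adj (graph_of_edges n E) i j =
  @adj (graph_of_rel (fun k l : 'I_n => r k l)) i j.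
Proof.
by move=> /allP/(_ _ (mem_iota_ord i))/allP/(_ _ (mem_iota_ord j))/eqP.
Qed.

Lemma path_graph7E (i j : 'I_7) :
  @adj (graph_of_edges 7 (nth (0, [::]) gap_codes 0).2) i j =
  @adj (path_graph 7) i j.
Proof. by apply: (same_adjP (r := fun k l => k.+1 == l)); vm_compute. Qed.

Lemma cycle_graph7E (i j : 'I_7) :
  @adj (graph_of_edges 7 (nth (0, [::]) gap_codes 1).2) i j =
  @adj (cycle_graph 7) i j.
Proof. by apply: (same_adjP (r := fun k l => k.+1 %% 7 == l)); vm_compute. Qed.

Lemma complete_graph4E (i j : 'I_4) :
  @adj (graph_of_edges 4 (nth (0, [::]) host_codes 2).2) i j =
  @adj (complete_graph 4) i j.
Proof. by apply: (same_adjP (r := fun k l => true)); vm_compute. Qed.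

Definition K23_label :
    complete_bipartite 2 3 -> graph_of_edges 5 (nth (0, [::]) host_codes 3).2 :=
  @unsplit 2 3.

Lemma K23_copy : induced_copy K23_label.
Proof.
split; first exact: (can_inj (@unsplitK 2 3)).
by case=> [[[|[|i]] lti]|[[|[|[|i]]] lti]] [[[|[|j]] ltj]|[[|[|[|j]]] ltj]].
Qed.

(** Row-major numbering of the two rows of the grid. *)
Definition grid_label (x : cartesian_product (path_graph 2) (path_graph 3)) :
    graph_of_edges 6 (nth (0, [::]) host_codes 4).2 :=
  inord (3 * (x.1 : 'I_2) + (x.2 : 'I_3)).

Lemma grid_copy : induced_copy grid_label.
Proof.
have valE x : grid_label x = 3 * (x.1 : 'I_2) + (x.2 : 'I_3) :> nat.
  by rewrite inordK //; case: x => [[[|[|i]] lti] [[|[|[|j]]] ltj]].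
have adjE x y : adj (grid_label x) (grid_label y) = adj x y.
  rewrite adj_graph_of_edges !valE.
  by case: x y => [[[|[|i]] lti] [[|[|[|j]]] ltj]]
                   [[[|[|k]] ltk] [[|[|[|l]]] ltl]].
split=> [x y /(congr1 val)/=|]; last exact: adjE.
rewrite !valE; case: x y => [x1 x2] [y1 y2] /= eq_xy.
by congr (_, _); apply: val_inj; move: eq_xy;
  case: x1 x2 y1 y2 => [[|[|i]] lti] [[|[|[|j]]] ltj]
                       [[|[|k]] ltk] [[|[|[|l]]] ltl].
Qed.

Definition relabelled n (r : rel 'I_n) E : Prop :=
  forall i j : 'I_n, @adj (graph_of_edges n E) i j = @adj (graph_of_rel r) i j.

Lemma relabelled_copy n (r : rel 'I_n) E : relabelled r E ->
  @induced_copy (graph_of_rel r) (graph_of_edges n E) id.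
Proof. by move=> adjE; split. Qed.

Lemma obstruction_code_graph o : o \in obstruction_codes ->
  exists2 F, List.In F host_graphs \/ List.In F gap_graphs &
    exists g : F -> graph_of_edges o.1 o.2, induced_copy g.
Proof.
have in_host k : k < 5 -> List.In (nth bull host_graphs k) host_graphs.
  by move: k; do 5?[case; first by move=> _; simpl; tauto].
have in_gap k : k < 7 -> List.In (nth bull gap_graphs k) gap_graphs.
  by move: k; do 7?[case; first by move=> _; simpl; tauto].
move=> o_in; rewrite !inE in o_in.
do 11?[case/orP: o_in => [/eqP->|o_in]]; last move/eqP: o_in => ->.
- by exists bull; [left; exact: (in_host 0)|exists id; split].
- by exists diamond; [left; exact: (in_host 1)|exists id; split].
- exists (complete_graph 4); [left; exact: (in_host 2)|exists id].
  exact/relabelled_copy/complete_graph4E.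
- exists (complete_bipartite 2 3); [left; exact: (in_host 3)|exists K23_label].
  exact: K23_copy.
- by exists (cartesian_product (path_graph 2) (path_graph 3));
    [left; exact: (in_host 4)|exists grid_label; exact: grid_copy].
- exists (path_graph 7); [right; exact: (in_gap 0)|exists id].
  exact/relabelled_copy/path_graph7E.
- exists (cycle_graph 7); [right; exact: (in_gap 1)|exists id].
  exact/relabelled_copy/cycle_graph7E.
- by exists F1; [right; exact: (in_gap 2)|exists id; split].
- by exists F2; [right; exact: (in_gap 3)|exists id; split].
- by exists F3; [right; exact: (in_gap 4)|exists id; split].
- by exists F4; [right; exact: (in_gap 5)|exists id; split].
- by exists F5; [right; exact: (in_gap 6)|exists id; split].
Qed.

(** Here the map must be onto: domination numbers do not pass to supergraphs.
    *)
Lemma gap_graph_code F : List.In F gap_graphs ->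
  exists2 o, o \in gap_codes & exists2 g : F -> graph_of_edges o.1 o.2,
    bijective g & {mono g : x y / adj x y}.
Proof.
have gap_nth k : k < 7 -> nth (0, [::]) gap_codes k \in gap_codes.
  by move=> ltk; rewrite mem_nth.
have id_bij (T : Type) : bijective (@id T) by exists id.
case=> [<-|[<-|[<-|[<-|[<-|[<-|[<-|[]]]]]]]].
- exists (nth (0, [::]) gap_codes 0); [exact: gap_nth|exists id => //].
  exact: path_graph7E.
- exists (nth (0, [::]) gap_codes 1); [exact: gap_nth|exists id => //].
  exact: cycle_graph7E.
- by exists (nth (0, [::]) gap_codes 2); [exact: gap_nth|exists id].
- by exists (nth (0, [::]) gap_codes 3); [exact: gap_nth|exists id].
- by exists (nth (0, [::]) gap_codes 4); [exact: gap_nth|exists id].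
- by exists (nth (0, [::]) gap_codes 5); [exact: gap_nth|exists id].
- by exists (nth (0, [::]) gap_codes 6); [exact: gap_nth|exists id].
Qed.

(** * Exponential weights and closed neighbourhoods *)

(** Membership in the closed neighbourhood of p, respectively in the union of
    those of p and q. *)
Definition covers (G : sgraph) (p u : G) : bool := (u == p) || adj u p.

Definition pair_covers (G : sgraph) (p q u : G) : bool :=
  covers p u || covers q u.

Section ExponentialWeight.
Variable G : sgraph.
Implicit Types (D : {set G}) (u v : G).

Lemma ohead_filter_iota (P : pred nat) m k n :
    n \in iota m k -> P n ->
  exists2 d, ohead [seq i <- iota m k | P i] = Some d & d <= n.
Proof.
elim: k m => [|k IHk] m //=; rewrite in_cons => mn Pn.
case: ifP => Pm.
  exists m => //; case/orP: mn => [/eqP->//|].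
  by rewrite mem_iota => /andP[/ltnW].
apply: IHk => //; case/orP: mn => // /eqP nm; by rewrite -nm Pn in Pm.
Qed.

(** The search range of Ddist loses nothing: the vertices of a path are
    distinct, so a path has fewer edges than the graph has vertices. *)
Lemma Ddist_le D u v p : Dpath D u v p ->
  exists2 d, Ddist D u v = Some d & d <= size p.
Proof.
move=> Dp; apply: ohead_filter_iota.
  rewrite mem_iota /= add0n; case/and5P: Dp => _ _ /card_uniqP size_up _ _.
  by rewrite -[(size p).+1]/(size (u :: p)) -size_up max_card.
by apply/existsP; exists (in_tuple p).
Qed.

Lemma Ddist_path D u v d : Ddist D u v = Some d ->
  exists2 p : seq G, size p = d & Dpath D u v p.
Proof.
rewrite /Ddist; case E: [seq _ <- _ | _] => [|n s] //= [nd].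
have: d \in n :: s by rewrite nd mem_head.
rewrite -E mem_filter => /andP[/existsP[p Dp] _].
by exists p => //; rewrite size_tuple.
Qed.

Local Open Scope ring_scope.

Definition contribution D u v : rat :=
  if Ddist D u v is Some d then (1 / 2 : rat) ^ (d%:Z - 1) else 0.

Lemma half_gt0 : 0 < 1 / 2 :> rat.
Proof. by rewrite divr_gt0 ?ltr01 ?ltr0n. Qed.

Lemma half_lt1 : 1 / 2 < 1 :> rat.
Proof. by rewrite ltr_pdivrMr ?ltr0n // mul1r ltr1n. Qed.

Lemma double_half : 2%:R * (1 / 2) = 1 :> rat.
Proof. by rewrite mulrC divfK ?pnatr_eq0. Qed.

(** The exponent d - 1 is negative for d = 0; factoring out 2 leaves natural
    exponents. *)
Lemma half_exp d : (1 / 2 : rat) ^ (d%:Z - 1) = 2%:R * (1 / 2) ^+ d.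
Proof. by rewrite expfzDr // mulrC; congr (_ * _). Qed.

Lemma contribution_ge0 D u v : 0 <= contribution D u v.
Proof.
rewrite /contribution; case: Ddist => [d|]; last exact: lexx.
by rewrite exprz_ge0 ?ltW ?half_gt0.
Qed.

Lemma contribution_ge D u v p : Dpath D u v p ->
  2%:R * (1 / 2) ^+ size p <= contribution D u v.
Proof.
case/Ddist_le=> d; rewrite /contribution => -> le_d.
rewrite half_exp ler_pM2l ?ltr0n //.
by rewrite ler_wiXn2l ?(ltW half_gt0) ?(ltW half_lt1).
Qed.

Lemma contribution_le_weight D u v : v \in D ->
  contribution D u v <= exp_weight D u.
Proof.
move=> vD; rewrite /exp_weight (bigD1 v) //= lerDl.
by apply: sumr_ge0 => w _; exact: contribution_ge0.
Qed.

(** The path from u to v may have at most one endvertex in D, which is why u is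
    not allowed to be another vertex of D. *)
Lemma weight_of_cover D u v : v \in D -> covers v u ->
  (u \in D -> u = v) -> 1 <= exp_weight D u.
Proof.
move=> vD uv uD; apply: le_trans (contribution_le_weight u vD).
case: (eqVneq u v) uv uD => [-> _ _|neq_uv].
  have Dvv : Dpath D v v [::].
    by rewrite /Dpath /= eqxx setUid (setIidPr _) ?sub1set // cards1.
  apply: le_trans (contribution_ge Dvv).
  by rewrite expr0 mulr1 ler1n.
rewrite /covers (negbTE neq_uv) /= => adj_uv uD.
have uND : u \notin D by apply: contra neq_uv => /uD->.
have Duv : Dpath D u v [:: v].
  rewrite /Dpath /= adj_uv eqxx inE neq_uv /= andbT.
  by rewrite setIUr (disjoint_setI0 _) ?set0U ?(setIidPr _) ?sub1set ?cards1 //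
     disjoint_sym disjoints1.
apply: le_trans (contribution_ge Duv).
by rewrite expr1 double_half lexx.
Qed.

(** The middle vertex m of the path u m p is not blocked: m differs from q
    because q is not adjacent to u. *)
Lemma common_neighbour_contribution p q u : ~~ pair_covers p q u ->
  [exists m, adj u m && adj m p] -> 1 / 2 <= contribution [set p; q] u p.
Proof.
rewrite /pair_covers /covers !negb_or -!andbA.
case/and4P=> neq_up _ neq_uq nadj_uq /existsP[m /andP[adj_um adj_mp]].
have neq_um : u != m by apply: contraTneq adj_um => <-; rewrite adj_irr.
have neq_mp : m != p by apply: contraTneq adj_mp => ->; rewrite adj_irr.
have neq_mq : m != q by apply: contraTneq adj_um => ->.
suff /contribution_ge: Dpath [set p; q] u p [:: m; p].
  by rewrite expr2 mulrA double_half mul1r.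
rewrite /Dpath /= adj_um adj_mp eqxx !inE !negb_or neq_um neq_up neq_mp neq_mq.
rewrite /= andbT.
suff ->: [set p; q] :&: [set u; p] = [set p] by rewrite cards1.
apply/setP=> z; rewrite !inE.
case: (eqVneq z p) => [|neq_zp] //=; first by rewrite orbT.
rewrite orbF; case: (eqVneq z q) => [->|] //=.
by rewrite eq_sym (negbTE neq_uq).
Qed.

Lemma weight_of_half_covers p q u : p != q -> ~~ pair_covers p q u ->
  [exists m, adj u m && adj m p] -> [exists m, adj u m && adj m q] ->
  1 <= exp_weight [set p; q] u.
Proof.
move=> neq_pq Nu up uq; rewrite /exp_weight big_setU1 ?inE //= big_set1.
have := common_neighbour_contribution Nu up.
have : 1 / 2 <= contribution [set p; q] u q.
  rewrite setUC; apply: common_neighbour_contribution uq.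
  by rewrite /pair_covers orbC.
move=> leq lep; apply: le_trans (lerD lep leq).
by rewrite -splitr lexx.
Qed.

(** Vertices of D in other components are at infinite distance and contribute
    nothing; so a positive weight needs a vertex of D in the component of u. *)
Lemma weight_witness D u : 1 <= exp_weight D u ->
  exists2 v, v \in D & connect (@adj G) u v.
Proof.
move=> wu.
suff /exists_inP[v vD uv]: [exists v in D, connect (@adj G) u v] by exists v.
apply: contraLR wu => /exists_inPn noD; rewrite -ltNge.
rewrite /exp_weight big1 // => v /noD; case E: Ddist => [d|] //.
case: (Ddist_path E) => p _ /and3P[up /eqP last_p _] /negP[].
by apply/connectP; exists p.
Qed.

(** One source at distance d gives 2 ^ (1 - d), which is below 1 once d > 1. *)
Lemma weight_single D u v : 1 <= exp_weight D u ->
    (forall w, w \in D -> connect (@adj G) u w -> w = v) ->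
  covers v u.
Proof.
move=> wu only_v; have [w wD uw] := weight_witness wu.
have eq_wv := only_v w wD uw; rewrite {w uw}eq_wv in wD.
have: 1 <= contribution D u v.
  apply: le_trans wu _; rewrite /exp_weight (bigD1 v) //= big1 ?addr0 //.
  move=> w /andP[{}wD /eqP neq_wv]; case E: Ddist => [d|] //.
  case: (Ddist_path E) => p _ /and3P[up /eqP last_p _]; case: neq_wv.
  by apply: only_v => //; apply/connectP; exists p.
rewrite /contribution; case E: Ddist => [d|] //; rewrite half_exp => le1.
have: (d <= 1)%N.
  rewrite leqNgt; apply: contraL le1 => d_gt1; rewrite -ltNge.
  apply: (@le_lt_trans _ _ (2%:R * (1 / 2) ^+ 2)); last first.
    by rewrite expr2 mulrA double_half mul1r half_lt1.
  rewrite ler_pM2l; last by rewrite ltr0n.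
  by rewrite ler_wiXn2l ?(ltW half_gt0) ?(ltW half_lt1).
case: (Ddist_path E) => p <- /and3P[up /eqP].
case: p up => [|a [|b p]] //= up <- _ _; rewrite /covers ?eqxx //.
by case/andP: up => -> _; rewrite orbT.
Qed.

Local Close Scope ring_scope.

Lemma setT_dominating : dominating [set: G].
Proof. by apply/forallP=> u; rewrite inE. Qed.

Lemma dominating_exp D : dominating D -> exp_dominating D.
Proof.
move=> /forallP domD; apply/forallP=> u.
case: (boolP (u \in D)) => [uD|uND].
  by apply: (weight_of_cover uD) => //; rewrite /covers eqxx.
have /implyP/(_ uND)/exists_inP[v vD uv] := domD u.
by apply: (weight_of_cover vD); rewrite /covers ?uv ?orbT ?(negbTE uND).
Qed.

Lemma domination_number_le D : dominating D -> domination_number G <= #|D|.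
Proof.
rewrite /domination_number; case: arg_minnP => [|E _]; last exact.
exact: setT_dominating.
Qed.

Lemma exp_domination_number_le D :
  exp_dominating D -> exp_domination_number G <= #|D|.
Proof.
rewrite /exp_domination_number.
case: arg_minnP => [|E _]; last exact.
exact: dominating_exp setT_dominating.
Qed.

Lemma domination_number_attained :
  exists2 D : {set G}, dominating D & #|D| = domination_number G.
Proof.
rewrite /domination_number; case: arg_minnP => [|D domD _]; last by exists D.
exact: setT_dominating.
Qed.

Lemma exp_domination_number_attained :
  exists2 D : {set G}, exp_dominating D & #|D| = exp_domination_number G.
Proof.
rewrite /exp_domination_number.
case: arg_minnP => [|D domD _]; last by exists D.
exact: dominating_exp setT_dominating.
Qed.

Lemma dominating_of_covers D :
  (forall u, exists2 v, v \in D & covers v u) -> dominating D.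
Proof.
move=> covD; apply/forallP=> u; apply/implyP=> uND.
have [v vD /orP[/eqP eq_uv|uv]] := covD u; first by rewrite eq_uv vD in uND.
by apply/exists_inP; exists v.
Qed.

Lemma covers_of_dominating D u :
  dominating D -> exists2 v, v \in D & covers v u.
Proof.
move=> /forallP/(_ u); case: (boolP (u \in D)) => [uD _|uND].
  by exists u; rewrite // /covers eqxx.
by move/exists_inP=> [v vD uv]; exists v; rewrite // /covers uv orbT.
Qed.

End ExponentialWeight.

(** * Graphs with domination number 3 and exponential domination number 2 *)

(** The left side is at most 2 and the right side at least 3: p and q dominate
    exponentially, because the vertices that they miss receive a half from
    each. *)
Lemma gap_domination_numbers (G : sgraph) (p q : G) : p != q ->
    (forall u, pair_covers p q u \/
       [exists m, adj u m && adj m p] /\ [exists m, adj u m && adj m q]) ->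
    (forall s t : G, exists u, ~~ pair_covers s t u) ->
  exp_domination_number G < domination_number G.
Proof.
move=> neq_pq half_cov no_pair.
apply: (@leq_ltn_trans 2).
  have <-: #|[set p; q]| = 2 by rewrite cards2 neq_pq.
  apply/exp_domination_number_le/forallP=> u.
  case: (boolP (u \in [set p; q])) => [uD|uND].
    by apply: (weight_of_cover uD); rewrite // /covers eqxx.
  case: (boolP (pair_covers p q u)) => [|Nu].
    case/orP; [set v := p | set v := q] => uv;
      apply: (@weight_of_cover _ _ _ v) => //;
      by rewrite ?(negbTE uND) // !inE eqxx ?orbT.
  case: (half_cov u) => [/(negP Nu)//|[up uq]].
  exact: weight_of_half_covers.
have [D domD <-] := domination_number_attained G; rewrite ltnNge.
apply/negP=> leD2; have [s [t sub_st]] : exists s t, D \subset [set s; t].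
  have [->|[s sD]] := set_0Vmem D; first by exists p, q; rewrite sub0set.
  exists s; have [D0|[t tD]] := set_0Vmem (D :\ s).
    by exists s; rewrite setUid -setD_eq0 D0.
  exists t; rewrite -subDset; apply/subsetP=> w wD; rewrite inE.
  move: leD2; rewrite (cardsD1 s) sD ltnS => /card_le1_eqP eqD.
  by apply/eqP; exact: eqD.
have [u] := no_pair s t; case/negP.
have [v vD uv] := covers_of_dominating u domD.
move: (subsetP sub_st v vD); rewrite !inE /pair_covers.
by case/orP=> /eqP <-; rewrite uv ?orbT.
Qed.

(** The hypotheses of gap_domination_numbers, decided on an edge list. *)
Definition gap_check n (E : seq (nat * nat)) : bool :=
  let V := iota 0 n in
  let cov p u := (u == p) || edge E u p in
  let via u p := has (fun m => edge E u m && edge E m p) V in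
  has (fun p => has (fun q => (p != q) &&
    all (fun u => [|| cov p u, cov q u | via u p && via u q]) V) V) V &&
  all (fun s => all (fun t => has (fun u => ~~ (cov s u || cov t u)) V) V) V.

Lemma gap_codes_check : all (fun o => gap_check o.1 o.2) gap_codes.
Proof. by vm_compute. Qed.

Lemma gap_check_sound (G : sgraph) n E (f : G -> graph_of_edges n E) :
    bijective f -> (forall x y, adj (f x) (f y) = adj x y) -> gap_check n E ->
  exp_domination_number G < domination_number G.
Proof.
move=> [g fK gK] monof /andP[].
have inj_f := can_inj fK.
have adjE x y : edge E (f x) (f y) = adj x y by rewrite -monof.
have eqE (x y : G) : ((f x : nat) == f y) = (x == y).
  by rewrite -(inj_eq inj_f).
have lift i : i \in iota 0 n -> exists x, i = f x.
  by case/ord_of_iota=> j ->; exists (g j); rewrite gK.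
have fV x : (f x : nat) \in iota 0 n by exact: mem_iota_ord.
have viaE u p : has (fun m => edge E (f u) m && edge E m (f p)) (iota 0 n) ->
    [exists m, adj u m && adj m p].
  case/hasP=> _ /lift[m ->]; rewrite !adjE => um.
  by apply/existsP; exists m.
case/hasP=> _ /lift[p ->] /hasP[_ /lift[q ->] /andP[neq_pq /allP half_cov]].
move/allP=> no_pair; apply: (@gap_domination_numbers _ p q).
- by rewrite -eqE.
- move=> u; have /or3P[] := half_cov _ (fV u); rewrite ?adjE ?eqE.
  + by move=> pu; left; rewrite /pair_covers /covers pu.
  + by move=> qu; left; rewrite /pair_covers /covers qu orbT.
  by case/andP=> /viaE-> /viaE->; right.
- move=> s t; have /allP/(_ _ (fV t))/hasP[_ /lift[u ->]] := no_pair _ (fV s).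
  by rewrite !adjE !eqE; exists u.
Qed.

(** * A terminating search for obstructions *)

(** The adjacencies inside a list of vertices, as a lower triangular matrix:
    the row of a vertex holds its adjacencies to the vertices after it. New
    vertices go to the front, so that adding one just adds a row. *)
Fixpoint pattern (G : sgraph) (vs : seq G) : seq bitseq :=
  if vs is z :: vs' then map (adj z) vs' :: pattern vs' else [::].

Fixpoint pat_adj (M : seq bitseq) (i j : nat) : bool :=
  if M is row :: M' then
    match i, j with
    | 0, 0 => false
    | 0, j'.+1 => nth false row j'
    | i'.+1, 0 => nth false row i'
    | i'.+1, j'.+1 => pat_adj M' i' j'
    end
  else false.

Definition adj_rows n E : seq bitseq := mkseq (fun i => mkseq (edge E i) i) n.

(** May c be the image of the next vertex of F, if m lists the images of the
    earlier ones and r is the row of the next vertex in F? *)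
Definition fits (A : rel nat) (r : bitseq) (m : seq nat) (c : nat) : bool :=
  all2 (fun a e => (c != a) && (A c a == e)) m r.

(** Backtracking over the partial embeddings m of F. The test for success is
    written with find, which stops at the first hit; under call-by-value, has
    evaluates its test on the whole list. *)
Fixpoint occurs (A : rel nat) N (F : seq bitseq) (m : seq nat) : bool :=
  if F is r :: F' then
    let ms := [seq rcons m c | c <- iota 0 N & fits A r m c] in
    find (occurs A N F') ms < size ms
  else true.

Definition obstructed (Fs : seq (seq bitseq)) (M : seq bitseq) : bool :=
  find (fun F => occurs (pat_adj M) (size M) F [::]) Fs < size Fs.

Fixpoint rows (n : nat) : seq bitseq :=
  if n is n'.+1 then [seq b :: s | b <- [:: true; false], s <- rows n']
  else [:: [::]].

Definition pattern_covers M p q i : bool :=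
  [|| i == p, i == q, pat_adj M i p | pat_adj M i q].

(** Pairs that dominate the pattern, those with the oldest vertices first. The
    search uses the first of them; any other would be sound, but this order
    keeps the tree small. *)
Definition covering_pairs M : seq (nat * nat) :=
  let V := rev (iota 0 (size M)) in
  [seq pq <- [seq (p, q) | p <- V, q <- V]
     | all (pattern_covers M pq.1 pq.2) V].

(** The possible rows of a vertex that the pair p, q leaves undominated. The
    two oldest vertices, which are the last two entries of a row, are x and y;
    the new vertex is adjacent to one of them. *)
Definition extensions M p q : seq (seq bitseq) :=
  [seq r :: M | r <- rows (size M)
     & [&& ~~ nth false r p, ~~ nth false r q & has id (drop (size r - 2) r)]].

(** Whether every way to grow M by witnesses runs into one of the graphs Fs
    within k steps; the bound k serves the structural recursion. *)
Fixpoint refuted Fs (k : nat) (M : seq bitseq) : bool :=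
  if k is k'.+1 then
    if obstructed Fs M then true
    else if covering_pairs M is pq :: _
    then all (refuted Fs k') (extensions M pq.1 pq.2) else false
  else false.

Definition obstruction_rows := [seq adj_rows o.1 o.2 | o <- obstruction_codes].

(** The pattern of w, v, y, x with w adjacent to v and x, and v adjacent to
    neither x nor y; b1 and b2 are the adjacencies of y to x and to w. *)
Definition start b1 b2 : seq bitseq :=
  [:: [:: true; b2; true]; [:: false; false]; [:: b1]; [::]].

(** The search starts at connected patterns, and here the four vertices already
    induce a connected graph. *)
Definition starts_adjacent :=
  [:: start true false; start true true; start false true].

(** One further vertex links y to x or to w. *)
Definition starts_one :=
  [seq r :: start false false | r <- rows 4
     & nth false r 2 && (nth false r 0 || nth false r 3)].

(** Two further vertices form with x and y a path of length three. *)
Definition starts_two :=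
  [seq [:: r', r & start false false] | r <- [seq r <- rows 4 | nth false r 3],
     r' <- [seq r' <- rows 5 | nth false r' 0 && nth false r' 3]].

Definition starts := starts_adjacent ++ starts_one ++ starts_two.

Lemma starts_refuted : all (refuted obstruction_rows 6) starts.
Proof. by vm_compute. Qed.

Lemma size_pattern (G : sgraph) (vs : seq G) : size (pattern vs) = size vs.
Proof. by elim: vs => //= z vs ->. Qed.

Lemma pat_adj_pattern (G : sgraph) (x0 : G) (vs : seq G) i j :
    i < size vs -> j < size vs ->
  pat_adj (pattern vs) i j = adj (nth x0 vs i) (nth x0 vs j).
Proof.
elim: vs i j => [|z vs IHvs] [|i] [|j] //= lti ltj.
- by rewrite adj_irr.
- by rewrite (nth_map x0).
- by rewrite (nth_map x0) // adj_sym.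
- exact: IHvs.
Qed.

Lemma mem_rows r : r \in rows (size r).
Proof.
elim: r => //= b r IHr; rewrite !mem_cat.
by case: b; rewrite (map_f _ IHr) ?orbT.
Qed.

Section OccursSound.
Variables (A : rel nat) (N n : nat) (E : seq (nat * nat)).

(** m lists the images of the first vertices of the graph with edge list E. *)
Definition partial_copy (m : seq nat) : Prop :=
  {in m, forall a, a < N} /\
  forall i j, j < i < size m ->
    nth 0 m i != nth 0 m j /\ A (nth 0 m i) (nth 0 m j) = edge E i j.

Lemma partial_copy_rcons m c : partial_copy m -> c < N ->
  fits A (mkseq (edge E (size m)) (size m)) m c -> partial_copy (rcons m c).
Proof.
case=> ltm copym ltc; rewrite /fits all2E size_mkseq eqxx andTb.
move=> /(all_nthP (0, false)) fit; split=> [a|i j].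
  by rewrite mem_rcons inE => /predU1P[->//|/ltm].
rewrite size_rcons ltnS => /andP[lt_ji le_im].
have lt_jm := leq_trans lt_ji le_im.
rewrite !nth_rcons lt_jm.
case: (ltngtP i (size m)) le_im => // [lt_im _|eq_im _].
  by apply: copym; rewrite lt_ji.
have := fit j; rewrite size_zip size_mkseq minnn => /(_ lt_jm).
rewrite nth_zip ?size_mkseq //= nth_mkseq // => /andP[-> /eqP->].
by rewrite eq_im.
Qed.

Lemma occursP m : size m <= n -> partial_copy m ->
    occurs A N (drop (size m) (adj_rows n E)) m ->
  exists2 m', size m' = n & partial_copy m'.
Proof.
have [k] := ubnP (n - size m); elim: k m => // k IHk m le_k le_mn copym.
have [lt_mn|ge_mn] := ltnP (size m) n; last first.
  by exists m => //; apply/eqP; rewrite eqn_leq le_mn.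
rewrite (drop_nth [::]) ?size_mkseq // nth_mkseq //=.
rewrite -has_find => /hasP[m1 /mapP[c]].
rewrite mem_filter mem_iota add0n => /andP[fit ltc] ->.
rewrite -(size_rcons m c) => occ; apply: IHk occ.
- by rewrite size_rcons subnS -ltnS prednK ?subn_gt0.
- by rewrite size_rcons.
- exact: partial_copy_rcons.
Qed.

End OccursSound.

Lemma edge_sym E i j : edge E i j = edge E j i.
Proof. by rewrite /edge eq_sym orbC. Qed.

(** The positions found by the search are turned into an induced copy by
    reading off the vertices of vs at these positions. *)
Lemma obstructed_sound (G : sgraph) (vs : seq G) : obstruction_free G ->
  uniq vs -> ~~ obstructed obstruction_rows (pattern vs).
Proof.
move=> freeG uniq_vs; rewrite /obstructed -has_find.
apply/negP=> /hasP[_ /mapP[[n E] inE ->]] /=.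
rewrite -(drop0 (adj_rows n E)) size_pattern => occ.
have copy0 : partial_copy (pat_adj (pattern vs)) (size vs) E [::].
  by split=> // i j; rewrite ltn0 andbF.
have [m sz_m [ltm copym]] :=
  @occursP _ _ n E [::] (leq0n n) copy0 occ.
have n_gt0 : 0 < n.
  by have /allP/(_ _ inE) : all (fun o => 0 < o.1) obstruction_codes.
case: vs uniq_vs occ copy0 ltm copym => [|x0 vs'].
  by move=> _ _ _ /(_ (nth 0 m 0)); rewrite mem_nth ?sz_m // => /(_ isT).
set vs := x0 :: vs' => uniq_vs _ _ ltm copym.
have ltn (i : 'I_n) : nth 0 m i < size vs.
  by apply: ltm; rewrite mem_nth ?sz_m.
pose f (i : graph_of_edges n E) : G := nth x0 vs (nth 0 m (i : 'I_n)).
apply: (freeG _ inE f).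
have below (i j : 'I_n) : j < i ->
    f i != f j /\ adj (f i) (f j) = edge E i j.
  move=> lt_ji.
  have [|neq_ij adjE] := copym i j; first by rewrite lt_ji sz_m /=.
  by rewrite /f nth_uniq ?ltn // -adjE (pat_adj_pattern x0) ?ltn.
have neq_f (i j : 'I_n) : i != j -> f i != f j.
  rewrite -val_eqE neq_ltn => /orP[] /below[] //.
  by rewrite eq_sym.
split=> [i j /eqP|i j].
  by apply: contraTeq => /neq_f.
rewrite adj_graph_of_edges.
case: (ltngtP i j) => [/below[_]|/below[_]|/val_inj->].
- by rewrite edge_sym adj_sym.
- by [].
- by rewrite adj_irr /edge eqxx.
Qed.

Section SearchSound.
Variables (G : sgraph) (A : {set G}) (x y v : G).
Hypothesis freeG : obstruction_free G.
Hypothesis no_pair : forall p q, p \in A -> q \in A ->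
  exists2 z, z \in A & ~~ pair_covers p q z.
Hypothesis only_v : forall z, z \in A -> z != v -> pair_covers x y z.
Hypotheses (xA : x \in A) (yA : y \in A) (vA : v \in A).

(** The witness z of a pair that dominates the known vertices is not one of
    them, so it differs from v and is adjacent to x or y; its row is therefore
    among the extensions that the search goes through. *)
Lemma refuted_sound k us :
    uniq (us ++ [:: v; y; x]) -> {subset us <= A} ->
  ~~ refuted obstruction_rows k (pattern (us ++ [:: v; y; x])).
Proof.
elim: k us => //= k IHk us; set vs := us ++ _ => uniq_vs usA.
rewrite (negbTE (obstructed_sound freeG uniq_vs)).
case Epq: covering_pairs => [//|[p q] pqs].
have : (p, q) \in covering_pairs (pattern vs) by rewrite Epq mem_head.
rewrite mem_filter => /andP[/allP cov_pq /allpairsP[[p' q'] /= []]].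
rewrite !mem_rev !mem_iota !add0n size_pattern => ltp' ltq' [eqp eqq].
have [ltp ltq] : p < size vs /\ q < size vs by rewrite eqp eqq.
have vsA i : i < size vs -> nth x vs i \in A.
  move=> lti; have := mem_nth x lti.
  rewrite mem_cat !inE => /or4P[/usA//|/eqP->|/eqP->|/eqP->] //.
have [z zA Nz] := no_pair (vsA p ltp) (vsA q ltq).
have zNvs : z \notin vs.
  apply: contra Nz => z_vs; pose i := index z vs.
  have lti : i < size vs by rewrite index_mem.
  have zi : nth x vs i = z by rewrite nth_index.
  have := cov_pq i; rewrite mem_rev mem_iota add0n size_pattern => /(_ lti).
  rewrite /pattern_covers /= !(pat_adj_pattern x) // zi /pair_covers /covers.
  case/or4P.
  - by move=> /eqP <-; rewrite zi eqxx.
  - by move=> /eqP <-; rewrite zi eqxx !orbT.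
  - by move=> ->; rewrite orbT.
  - by move=> ->; rewrite !orbT.
have [neq_zv neq_zy neq_zx] : [/\ z != v, z != y & z != x].
  by move: zNvs; rewrite mem_cat !inE !negb_or => /and4P[].
have zusA : {subset z :: us <= A}.
  by move=> u; rewrite inE => /predU1P[->//|/usA].
apply: contraNN (IHk (z :: us) (introT andP (conj zNvs uniq_vs)) zusA).
move/allP; apply; apply/mapP; exists (map (adj z) vs) => //.
rewrite mem_filter size_pattern -(size_map (adj z)) mem_rows andbT.
move: Nz; rewrite /pair_covers /covers !negb_or -!andbA.
rewrite !(nth_map x) // => /and4P[_ -> _ ->] /=.
have := only_v zA neq_zv.
rewrite /pair_covers /covers (negbTE neq_zx) (negbTE neq_zy).
rewrite /vs map_cat size_cat !size_map /= drop_cat size_map.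
rewrite -addnBA // ltnNge leq_addr addKn /= orbF orbC.
by [].
Qed.
End SearchSound.

(** * Connected graphs without obstructions have domination number at most 2 *)

Section Components.
Variable G : sgraph.
Implicit Types B : {set G}.

(** Connectedness of the subgraph induced by B, in terms of cuts: this form is
    easy to extend by a vertex and directly yields the edge that links the
    closed neighbourhoods of x and y. *)
Definition linked B : bool :=
  [forall X : {set G}, (X != set0) && (X \proper B) ==>
    [exists a in X, [exists b in B :\: X, adj a b]]].

Lemma linkedP B (X : {set G}) x y : linked B -> X \subset B ->
    x \in X -> y \in B :\: X ->
  exists a b, [/\ a \in X, b \in B :\: X & adj a b].
Proof.
move=> /forallP/(_ X) linkB sXB xX yBX.
suff /(implyP linkB)/exists_inP[a aX /exists_inP[b bBX ab]]:
  (X != set0) && (X \proper B) by exists a, b.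
apply/andP; split; first by apply/set0Pn; exists x.
rewrite properE sXB; apply/subsetPn; exists y; first by case/setDP: yBX.
by case/setDP: yBX.
Qed.

Lemma linked1 u : linked [set u].
Proof.
apply/forallP=> X; apply/implyP=> /andP[X0]; rewrite properE subset1.
by rewrite (negbTE X0) orbF => /andP[/eqP->]; rewrite subxx.
Qed.

(** A cut of v |: B either cuts B, or separates v from all of B, and then the
    edge between v and w crosses it. *)
Lemma linked_add B v w : linked B -> w \in B -> adj v w -> linked (v |: B).
Proof.
move=> linkB wB vw; apply/forallP=> X; apply/implyP=> /andP[X0].
rewrite properE => /andP[sX nsX].
have edge_in a b : a \in X -> b \in (v |: B) :\: X -> adj a b ->
    [exists a in X, [exists b in (v |: B) :\: X, adj a b]].
  move=> aX bX ab; apply/exists_inP; exists a => //.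
  by apply/exists_inP; exists b.
have [t tX|noB] := pickP [pred t in X | t \in B].
  have [sBX|/subsetPn[s sB sNX]] := boolP (B \subset X).
    have vNX : v \notin X.
      by apply: contra nsX => vX; rewrite subUset sub1set vX.
    apply: (edge_in w v); rewrite ?(subsetP sBX) // ?inE ?vNX ?eqxx //.
    by rewrite adj_sym.
  have [|||a [b [/setIP[aX _] bBX ab]]] :=
    linkedP (X := X :&: B) (x := t) (y := s) linkB.
  - exact: subsetIr.
  - by rewrite inE.
  - by rewrite !inE sB (negbTE sNX).
  apply: (edge_in a b) => //; move: bBX; rewrite !inE => /andP[+ bB].
  by rewrite bB orbT !andbT.
have wNX : w \notin X by move: (noB w); rewrite /= wB andbT => ->.
case/set0Pn: X0 => t tX; case/setU1P: (subsetP sX t tX) => [eq_tv|tB].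
  by apply: (edge_in v w); rewrite // -?eq_tv // !inE wNX wB orbT.
by have := noB t; rewrite /= tX tB.
Qed.

Definition two_dominated B : bool :=
  [exists p in B, [exists q in B, [forall z in B, pair_covers p q z]]].

Lemma two_dominatedI B p q : p \in B -> q \in B ->
  {in B, forall z, pair_covers p q z} -> two_dominated B.
Proof.
move=> pB qB covB; apply/exists_inP; exists p => //; apply/exists_inP.
by exists q => //; apply/forall_inP.
Qed.

(** If v |: B were not dominated by a pair, the search would apply, and it
    refutes every configuration formed by x, y, v, w and a link between x and
    y. *)
Lemma grow_at_neighbour B x y v w : obstruction_free G -> linked B ->
    x \in B -> y \in B -> {in B, forall z, pair_covers x y z} ->
    v \notin B -> w \in B -> adj v w -> adj w x ->
  two_dominated (v |: B).
Proof.
move=> freeG linkB xB yB covB vNB wB vw wx; apply: contraT => no_two.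
have no_pair p q : p \in v |: B -> q \in v |: B ->
    exists2 z, z \in v |: B & ~~ pair_covers p q z.
  move=> pA qA; apply/exists_inP; apply: contraNT no_two.
  move=> /exists_inPn covA; apply: (two_dominatedI pA qA) => z /covA.
  by rewrite negbK.
have only_v z : z \in v |: B -> z != v -> pair_covers x y z.
  by rewrite !inE => /predU1P[->|/covB//]; rewrite eqxx.
have sBA z : z \in B -> z \in v |: B by move=> zB; rewrite !inE zB orbT.
have vA : v \in v |: B by rewrite !inE eqxx.
have neqB z : z \in B -> z != v by move=> zB; apply: contraNneq vNB => <-.
have [z1 z1A] := no_pair x y (sBA x xB) (sBA y yB).
case: (eqVneq z1 v) => [-> {z1 z1A}|/(only_v _ z1A)->//].
rewrite /pair_covers /covers !negb_or -!andbA => /and4P[neq_vx nvx neq_vy nvy].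
have neq_wx : w != x by apply: contraNneq nvx => <-.
have neq_wy : w != y by apply: contraNneq nvy => <-.
have neq_yx : y != x.
  (* If x alone dominates B, then x and w dominate v |: B. *)
  apply/eqP=> eq_yx; have [z] := no_pair x w (sBA x xB) (sBA w wB).
  rewrite !inE => /predU1P[->|/covB]; rewrite /pair_covers /covers ?vw ?orbT //.
  by rewrite eq_yx orbb => ->.
have contra_start us : uniq (us ++ [:: v; y; x]) -> {subset us <= B} ->
    pattern (us ++ [:: v; y; x]) \in starts -> false.
  move=> uniq_vs usB /(allP starts_refuted).
  apply: contraTT => _; apply: (refuted_sound freeG no_pair only_v) => //.
  - exact: sBA.
  - exact: sBA.
  - by move=> u /usB/sBA.
have pat_base : pattern [:: w; v; y; x] =
    start (adj y x) (adj w y).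
  by rewrite /start /= (adj_sym w v) vw wx (negbTE nvy) (negbTE nvx).
have uniq_base : uniq [:: w; v; y; x].
  by rewrite /= !inE !negb_or neqB // neq_wx neq_wy neq_vx neq_vy neq_yx.
case: (boolP (adj y x || adj w y)) => [link|].
  apply: (contra_start [:: w]) => //; first by move=> u; rewrite inE => /eqP->.
  by rewrite [_ ++ _]/= pat_base; move: link; case: (adj y x); case: (adj w y).
rewrite negb_or => /andP[nyx nwy].
rewrite (negbTE nyx) (negbTE nwy) in pat_base.
(* An edge of B that leaves the closed neighbourhood of x ends in a vertex b
   dominated by y only; it provides the link. *)
pose X := [set z in B | covers x z].
have [|||a [b [/setIdP[aB ax] /setDP[bB bNX] ab]]] :=
  linkedP (X := X) (x := x) (y := y) linkB.
- by apply/subsetP=> z /setIdP[].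
- by rewrite inE xB /covers eqxx.
- by rewrite !inE yB /covers (negbTE neq_yx) (negbTE nyx).
move: bNX; rewrite inE bB /= /covers negb_or => /andP[neq_bx nbx].
have {ax} neq_ax_adj : a != x /\ adj a x.
  move: ax; rewrite /covers; case: (eqVneq a x) => //= eq_ax _.
  by rewrite -eq_ax adj_sym ab in nbx.
have [neq_ax ax] := neq_ax_adj.
have := covB b bB; rewrite /pair_covers /covers (negbTE neq_bx) (negbTE nbx) /=.
have in_starts1 r : size r = 4 ->
    nth false r 2 && (nth false r 0 || nth false r 3) ->
    r :: pattern [:: w; v; y; x] \in starts.
  move=> sz_r cond; rewrite pat_base mem_cat mem_cat orbCA; apply/orP; left.
  by apply/mapP; exists r; rewrite // mem_filter cond -sz_r mem_rows.
case: (eqVneq b y) ab => [->|neq_by] ab.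
  have neq_aw : a != w by apply: contraTneq ab => ->.
  have neq_ay : a != y by apply: contraTneq ab => ->; rewrite adj_irr.
  move=> _; apply: (contra_start [:: a; w]).
  - rewrite [_ ++ _]/= cons_uniq uniq_base andbT !inE !negb_or.
    by rewrite neq_aw neqB // neq_ay.
  - by move=> u; rewrite !inE => /orP[] /eqP->.
  - by apply: in_starts1; rewrite //= ab ax ?orbT.
move=> /= bY.
have neq_bw : b != w by apply: contraNneq nbx => ->.
case: (eqVneq a w) ab => [->|neq_aw] ab.
  apply: (contra_start [:: b; w]).
  - rewrite [_ ++ _]/= cons_uniq uniq_base andbT !inE !negb_or.
    by rewrite neq_bw neqB // neq_bx neq_by.
  - by move=> u; rewrite !inE => /orP[] /eqP->.
  - by apply: in_starts1; rewrite //= (adj_sym b w) ab bY.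
have neq_ay : a != y by apply: contraTneq ax => ->.
have neq_ba : b != a by apply: contraTneq ab => ->; rewrite adj_irr.
apply: (contra_start [:: b; a; w]).
- rewrite [_ ++ _]/= 2!cons_uniq uniq_base andbT !inE !negb_or.
  by rewrite neq_bw neq_ba !neqB // neq_bx neq_by neq_aw neq_ax neq_ay.
- by move=> u; rewrite !inE => /or3P[] /eqP->.
rewrite [_ ++ _]/= -[pattern _]/[:: _, _ & pattern [:: w; v; y; x]] pat_base.
rewrite 2!mem_cat orbA; apply/orP; right; rewrite /starts_two.
apply/allpairsP; exists ([seq adj a u | u <- [:: w; v; y; x]],
  [seq adj b u | u <- [:: a; w; v; y; x]]); split=> //.
- rewrite mem_filter (mem_rows [seq adj a u | u <- [:: w; v; y; x]]) andbT.
  by rewrite /= ax.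
- rewrite mem_filter (mem_rows [seq adj b u | u <- [:: a; w; v; y; x]]).
  by rewrite andbT /= (adj_sym b a) ab bY.
Qed.

Lemma grow_two_dominated B v w : obstruction_free G -> linked B ->
  two_dominated B -> v \notin B -> w \in B -> adj v w -> two_dominated (v |: B).
Proof.
move=> freeG linkB /exists_inP[x xB /exists_inP[y yB /forall_inP covB]].
move=> vNB wB vw; have := covB w wB; rewrite {1}/pair_covers /covers.
have covA : pair_covers x y v -> two_dominated (v |: B).
  move=> xyv; apply: (@two_dominatedI _ x y); rewrite ?inE ?xB ?yB ?orbT //.
  by move=> z /setU1P[->//|/covB].
case: (eqVneq w x) => [eq_wx _|_].
  by apply: covA; rewrite /pair_covers /covers -eq_wx vw orbT.
case: (eqVneq w y) => [eq_wy _|_ /= /orP[wx|wy]].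
- by apply: covA; rewrite /pair_covers /covers -eq_wy vw !orbT.
- exact: (@grow_at_neighbour B x y v w).
- apply: (@grow_at_neighbour B y x v w) => // z /covB.
  by rewrite /pair_covers orbC.
Qed.

(** A largest linked set that contains u and is dominated by a pair cannot have
    a neighbour outside, since that vertex could be added; so it contains the
    component of u. *)
Lemma component_two_dominated u : obstruction_free G ->
  exists p q, forall z, connect (@adj G) u z -> pair_covers p q z.
Proof.
move=> freeG; pose P B := [&& u \in B, linked B & two_dominated B].
have Pu : P [set u].
  rewrite /P inE eqxx linked1; apply: (@two_dominatedI _ u u); rewrite ?inE //.
  by move=> z; rewrite inE => /eqP->; rewrite /pair_covers /covers eqxx.
pose B := [arg max_(B > [set u] | P B) #|B|].
have [/and3P[uB linkB twoB] maxB] : P B /\ forall B', P B' -> #|B'| <= #|B|.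
  by rewrite /B; case: arg_maxnP.
have /exists_inP[p pB /exists_inP[q qB /forall_inP covB]] := twoB.
exists p, q => z uz; apply: covB.
suff clB : closed (@adj G) B by rewrite -(closed_connect clB uz).
apply: intro_closed => [|w v wv wB].
  by apply: sym_connect_sym => a b; exact: adj_sym.
apply: contraT => vNB; have: P (v |: B).
  have vw : adj v w by rewrite adj_sym.
  rewrite /P inE uB orbT (linked_add linkB wB vw).
  exact: grow_two_dominated vw.
by move/maxB; rewrite cardsU1 vNB ltnn.
Qed.

(** Two vertices of D in the component pay for a dominating pair; a single one
    has to dominate the component by itself. *)
Lemma exp_dominating_component D u : obstruction_free G -> exp_dominating D ->
  exists C : {set G}, #|C| <= #|[set d in D | connect (@adj G) u d]| /\
    forall z, connect (@adj G) u z -> exists2 d, d \in C & covers d z.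
Proof.
move=> freeG /forallP expD; set Du := [set d in D | _].
have sym_c : connect_sym (@adj G).
  by apply: sym_connect_sym => a b; exact: adj_sym.
have [le2|lt2] := leqP 2 #|Du|.
  have [p [q cov]] := component_two_dominated u freeG.
  exists [set p; q]; split=> [|z /cov].
    by rewrite (leq_trans _ le2) // cards2; case: eqP.
  by case/orP=> cz; [exists p | exists q]; rewrite ?inE ?eqxx ?orbT.
have [d dD ud] := weight_witness (expD u).
exists Du; split=> // z uz; exists d; first by rewrite inE dD.
apply: (weight_single (expD z)) => d' d'D zd'.
move: lt2; rewrite ltnS => /card_le1_eqP; apply; rewrite inE ?dD ?d'D //.
exact: connect_trans uz zd'.
Qed.

(** The sets obtained for the components, one for each root, are glued
    together; their sizes add up to at most the size of D. *)
Lemma obstruction_free_domination_number : obstruction_free G ->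
  domination_number G = exp_domination_number G.
Proof.
move=> freeG; apply/eqP; rewrite eqn_leq; apply/andP; split; last first.
  have [D domD <-] := domination_number_attained G.
  exact/exp_domination_number_le/dominating_exp.
have [D expD <-] := exp_domination_number_attained G.
have sym_c : connect_sym (@adj G).
  by apply: sym_connect_sym => a b; exact: adj_sym.
have /fin_all_exists[C /all_and2[leC covC]] :=
  fun u => exp_dominating_component u freeG expD.
pose e := @adj G; pose D' := \bigcup_(r in roots e) C r.
apply: (@leq_trans #|D'|).
  apply/domination_number_le/dominating_of_covers => z.
  have root_z : connect e (fingraph.root e z) z.
    by rewrite /e sym_c connect_root.
  have [d dC dz] := covC _ z root_z; exists d => //.
  by apply/bigcupP; exists (fingraph.root e z); rewrite // inE roots_root.
apply: (@leq_trans (\sum_(r in roots e) #|C r|)).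
  rewrite /D'; elim/big_rec2: _ => [|r n S _ leS]; first by rewrite cards0.
  by rewrite (leq_trans (leq_card_setU _ _)) // leq_add2l.
rewrite -[#|D|]sum1_card.
rewrite [leqRHS](partition_big (fingraph.root e) (mem (roots e))); last first.
  by move=> d _; exact: roots_root.
apply: leq_sum => r; rewrite inE => /eqP root_r; apply: leq_trans (leC r) _.
rewrite -sum1_card; apply/eq_leq/eq_bigl => d.
by rewrite inE -(root_connect sym_c) root_r eq_sym.
Qed.

End Components.

Theorem theorem1 (G : sgraph)
    (hG : induced_free [:: bull; diamond; complete_graph 4; complete_bipartite 2 3;
                   cartesian_product (path_graph 2) (path_graph 3)] G) :
  (forall S : {set G},
     domination_number (induced S) = exp_domination_number (induced S))
  <-> induced_free [:: path_graph 7; cycle_graph 7; F1; F2; F3; F4; F5] G.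
Proof.
split=> [eq_gamma S F /gap_graph_code[o o_gap [g bij_g mono_g]]|free_gap S].
  case=> f bij_f mono_f.
  have mono_gf x y : adj ((g \o f) x) ((g \o f) y) = adj x y.
    exact: etrans (mono_g _ _) (mono_f _ _).
  have := gap_check_sound (bij_comp bij_g bij_f) mono_gf
    (allP gap_codes_check o o_gap).
  by rewrite eq_gamma ltnn.
apply: obstruction_free_domination_number => o.
case/obstruction_code_graph=> F inF [g copy_g] f copy_f.
have copy_F := induced_copy_comp (induced_copy_comp copy_g copy_f)
  (val_induced_copy S).
by case: inF => inF; [apply: induced_free_copy hG inF copy_F
                   | apply: induced_free_copy free_gap inF copy_F].
Qed.
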